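(* Let $G$ be a graph with $m\ge1$ edges and fixed orientations, and write $\det(\lambda I_m-\mathcal{H}(G))=\lambda^m+c_1\lambda^{m-1}+\cdots+c_{m-1}\lambda+c_m$. Then for $1\le k\le m$, $$c_k=(-1)^k\sum_{B\in\mathcal{B}_k}(-1)^{m(B)+c^o_-(B)+c^e_+(B)}\,2^{c(B)}\,\varpi_v(B),$$ where $\mathcal{B}_k$ is the set of all basic subgraphs of $\Lambda(G)$ on $k$ vertices.
   Context: Graphs are finite, simple and undirected. Fix an orientation of every edge (tail $e^-$, head $e^+$) and a cyclic orientation of every triangle; $\mathcal{B}$ is the $|E|\times|V|$ matrix with $b_{ev}=-1$ if $v=e^-$, $1$ if $v=e^+$, $0$ otherwise; $\mathcal{C}$ is the $|T|\times|E|$ matrix ($T$ the set of triangles) with $c_{\vartriangle e}=\pm1$ if $e$ is an edge of $\vartriangle$ (sign $+$ iff the orientation of $e$ agrees with that of $\vartriangle$) and $0$ otherwise; $\mathcal{H}(G)=\mathcal{B}\mathcal{B}^{\intercal}+\mathcal{C}^{\intercal}\mathcal{C}$. $\triangle(e)$ is the number of triangles containing edge $e$. For distinct edges $e,e'$: $e\leftrightarrow e'$ means $e^+=e'^-$ or $e'^+=e^-$; $e\overset{\pm}{\sim}e'$ means $e^+=e'^+$ or $e^-=e'^-$; $e\vartriangle e'$ means they lie in a common triangle. $\Lambda(G)$ is the signed graph with vertex set $E(G)$, in which each vertex $e$ has weight $w(e)=\triangle(e)+2$ (the number of loops attached at $e$), distinct $e,e'$ are joined by a positive edge if $e\overset{\pm}{\sim}e'$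 and not $e\vartriangle e'$, and by a negative edge if $e\leftrightarrow e'$ and not $e\vartriangle e'$. The sign of a cycle in $\Lambda(G)$ is the product of the signs of its edges. A basic subgraph of $\Lambda(G)$ on $k$ vertices is a subgraph of the loopless signed graph on $k$ vertices each of whose components is an isolated vertex, a single edge, or a cycle of length at least $3$. For such $B$: $m(B)$ is the number of single-edge components, $c(B)$ the number of cycle components, $c^o_-(B)$ the number of negative cycles of odd length, $c^e_+(B)$ the number of positive cycles of even length, and $\varpi_v(B)$ the product of $w(v)$ over the isolated-vertex components $v$ of $B$ (equal to $1$ if there are none). *)

(* Defs.v *)
From HB Require Import structures.
From mathcomp Require Import all_boot all_order all_algebra.

Set Implicit Arguments.
Unset Strict Implicit.
Unset Printing Implicit Defensive.

Import Order.TTheory GRing.Theory Num.Theory.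
Local Open Scope ring_scope.

Record sgraph := SGraph {
  vertex :> finType;
  adj : rel vertex;
  adj_sym : symmetric adj;
  adj_irr : irreflexive adj }.

Section Graph.
Variable G : sgraph.

Definition edges : {set {set G}} :=
  [set [set p.1; p.2] | p : G * G & adj p.1 p.2].

Definition triangles : {set {set G}} :=
  [set t : {set G} | (#|t| == 3%N) &&
    [forall x in t, forall y in t, (x != y) ==> adj x y]].

Definition edge : Type := {e : {set G} | e \in edges}.
Definition triangle : Type := {t : {set G} | t \in triangles}.

End Graph.

HB.instance Definition _ (G : sgraph) := [isSub of edge G for @sval _ _].
HB.instance Definition _ (G : sgraph) := [Finite of edge G by <:].
HB.instance Definition _ (G : sgraph) := [isSub of triangle G for @sval _ _].
HB.instance Definition _ (G : sgraph) := [Finite of triangle G by <:].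

Section Orientations.
Variable G : sgraph.
Local Notation edge := (edge G).
Local Notation triangle := (triangle G).

Record edge_orientation := EdgeOrientation {
  tail : edge -> G;
  head : edge -> G;
  tail_headE : forall e, val e = [set tail e; head e] }.

(* A cyclic orientation is given by one of its three cyclic listings of the
   vertices; only [next (tour t)], which is invariant under rotation of the
   listing, is ever used. *)
Record triangle_orientation := TriangleOrientation {
  tour : triangle -> 3.-tuple G;
  tourE : forall t, val t = [set x in tour t] }.

Definition edge_in_triangle (e : edge) (t : triangle) : bool :=
  val e \subset val t.

Definition ntriangles (e : edge) : nat :=
  #|[set t : triangle | edge_in_triangle e t]|.

Section Oriented.
Variables (o : edge_orientation) (r : triangle_orientation).

Definition incidence : 'M[int]_(#|{: edge}|, #|G|) :=
  \matrix_(i, j)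
    let e := enum_val i in let v := enum_val j in
    if v == tail o e then -1 else if v == head o e then 1 else 0.

Definition agrees (e : edge) (t : triangle) : bool :=
  next (tour r t) (tail o e) == head o e.

Definition triangle_edge : 'M[int]_(#|{: triangle}|, #|{: edge}|) :=
  \matrix_(i, j)
    let t := enum_val i in let e := enum_val j in
    if edge_in_triangle e t then (if agrees e t then 1 else -1) else 0.

Definition hodge : 'M[int]_#|{: edge}| :=
  incidence *m incidence^T + triangle_edge^T *m triangle_edge.

End Oriented.

Section LineRelations.
Variable o : edge_orientation.
Implicit Types e f : edge.

Definition consecutive e f : bool :=
  (head o e == tail o f) || (head o f == tail o e).

Definition co_oriented e f : bool :=
  (head o e == head o f) || (tail o e == tail o f).

Definition share_triangle e f : bool :=
  [exists t : triangle, edge_in_triangle e t && edge_in_triangle f t].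

Definition line_pos e f : bool :=
  [&& e != f, co_oriented e f & ~~ share_triangle e f].

Definition line_neg e f : bool :=
  [&& e != f, consecutive e f & ~~ share_triangle e f].

End LineRelations.
End Orientations.

(* Weighted signed graphs. Loops are recorded only through [weight], so the
   edge sets below are those of the loopless signed graph. *)
Record wsgraph := WSGraph {
  ws_vertex :> finType;
  weight : ws_vertex -> nat;
  pos_edges : {set {set ws_vertex}};
  neg_edges : {set {set ws_vertex}};
  ws_card2 : forall f, f \in pos_edges :|: neg_edges -> #|f| = 2%N;
  ws_disjoint : [disjoint pos_edges & neg_edges] }.

Section SignedGraph.
Variable L : wsgraph.

Definition sgn_edge (f : {set L}) : int := if f \in neg_edges L then -1 else 1.

(* A subgraph is a pair (vertex set, edge set). *)
Definition is_subgraph (B : {set L} * {set {set L}}) : bool :=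
  (B.2 \subset pos_edges L :|: neg_edges L) && (cover B.2 \subset B.1).

Variable B : {set L} * {set {set L}}.

Definition sub_adj : rel L := [rel x y | [set x; y] \in B.2].

Definition components : {set {set L}} :=
  equivalence_partition (connect sub_adj) B.1.

Definition comp_edges (C : {set L}) : {set {set L}} :=
  [set f in B.2 | f \subset C].

Definition is_isolated (C : {set L}) : bool :=
  (#|C| == 1%N) && (comp_edges C == set0).

Definition is_single_edge (C : {set L}) : bool :=
  (#|C| == 2%N) && (comp_edges C == [set C]).

Definition is_cycle (C : {set L}) : bool :=
  (3 <= #|C|)%N &&
  [exists s : #|C|.-tuple L,
    [&& uniq s, C == [set x in s] &
        comp_edges C == [set [set x; next s x] | x in C]]].

Definition cycle_sgn (C : {set L}) : int := \prod_(f in comp_edges C) sgn_edge f.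

Definition is_basic : bool :=
  is_subgraph B &&
  [forall C in components, [|| is_isolated C, is_single_edge C | is_cycle C]].

Definition n_single_edges : nat := #|[set C in components | is_single_edge C]|.

Definition n_cycles : nat := #|[set C in components | is_cycle C]|.

Definition n_neg_odd_cycles : nat :=
  #|[set C in components | [&& is_cycle C, odd #|C| & cycle_sgn C == -1]]|.

Definition n_pos_even_cycles : nat :=
  #|[set C in components | [&& is_cycle C, ~~ odd #|C| & cycle_sgn C == 1]]|.

Definition isolated_weight : nat :=
  \prod_(v : L | ([set v] \in components) && is_isolated [set v]) weight v.

End SignedGraph.

Section Lambda.
Variables (G : sgraph) (o : edge_orientation G).

Definition Lambda_pos : {set {set edge G}} :=
  [set [set p.1; p.2] | p : edge G * edge G & line_pos o p.1 p.2].

Definition Lambda_neg : {set {set edge G}} :=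
  [set [set p.1; p.2] | p : edge G * edge G & line_neg o p.1 p.2].

Lemma tail_neq_head e : tail o e != head o e.
Proof.
have /imsetP[[x y]] := valP e; rewrite inE /= => axy.
rewrite (tail_headE o) => E; apply/eqP => th.
have nxy : x != y by apply: contraTneq axy => ->; rewrite adj_irr.
by have := cards2 x y; rewrite -E th setUid cards1 nxy.
Qed.

Lemma co_oriented_consecutive e f :
  e != f -> co_oriented o e f -> ~~ consecutive o e f.
Proof.
move=> nef co; apply/negP => cs; move: (tail_neq_head e) (tail_neq_head f).
case/orP: co => /eqP E1; case/orP: cs => /eqP E2.
- by rewrite -E1 -E2 eqxx.
- by rewrite E1 E2 eqxx.
- by rewrite E1 E2 eqxx.
- by rewrite E2 E1 eqxx.
Qed.

Lemma Lambda_card2 f : f \in Lambda_pos :|: Lambda_neg -> #|f| = 2%N.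
Proof.
by case/setUP => /imsetP[[a b]]; rewrite inE => /and3P[/= nab _ _] ->;
  rewrite cards2 nab.
Qed.

Lemma Lambda_disjoint : [disjoint Lambda_pos & Lambda_neg].
Proof.
rewrite disjoint_subset; apply/subsetP => F /imsetP[[a b]].
rewrite inE => /and3P[/= nab co _] ->; rewrite inE; apply/negP.
case/imsetP => -[c d]; rewrite inE => /and3P[/= ncd cs _] E.
have := co_oriented_consecutive nab co.
have: c \in [set a; b] by rewrite E set21.
have: d \in [set a; b] by rewrite E set22.
rewrite !inE => /orP[] /eqP Ed /orP[] /eqP Ec; subst c d.
- by rewrite eqxx in ncd.
- by rewrite /consecutive orbC -/(consecutive o b a) cs.
- by rewrite cs.
- by rewrite eqxx in ncd.
Qed.

Definition Lambda : wsgraph :=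
  @WSGraph (edge G) (fun e => (ntriangles e + 2)%N) Lambda_pos Lambda_neg
    Lambda_card2 Lambda_disjoint.

End Lambda.

(* Main.v *)
(* By the orientation rules, the off-diagonal entries of B B^T and C^T C cancel
   at two edges of a common triangle, so the Hodge Laplacian is the signed
   adjacency matrix of Lambda(G) with the weights w on the diagonal. Expanding
   the determinant, c_k is (-1)^k times the sum over vertex sets S of size k and
   permutations s of S of sgn(s) prod_(x in S) H(x, s x). Send (S, s) to the
   subgraph with edges {x, s x}: its components are the orbits of s, and the
   summand is nonzero only if it is a basic subgraph of Lambda(G), in which case
   it factors over the components and depends on the subgraph only. A basic
   subgraph comes from 2^c permutations, one for each choice of a direction on
   each of its c cycles. *)
Require Import Defs.
From mathcomp Require Import all_boot all_order all_fingroup all_algebra.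

Set Implicit Arguments.
Unset Strict Implicit.
Unset Printing Implicit Defensive.

Import Order.TTheory GRing.Theory Num.Theory.
Local Open Scope ring_scope.

(** * Coefficients of the characteristic polynomial *)

(** In the Leibniz expansion each factor is the constant [- A i (s i)] plus, at fixed points only,
    ['X]. Choosing the constants on a set [J] leaves degree [n - #|J|], so the wanted coefficient
    selects [#|J| = k] with [s] fixing every index outside [J]. *)
Lemma coef_char_poly_principal_minors (R : comNzRingType) (n k : nat)
    (A : 'M[R]_n) : (k <= n)%N ->
  (char_poly A)`_(n - k) =
  (-1) ^+ k * \sum_(p : {set 'I_n} * {perm 'I_n} |
                    (#|p.1| == k) && perm_on p.1 p.2)
                 (-1) ^+ p.2 * \prod_(i in p.1) A i (p.2 i).
Proof.
move=> le_kn; rewrite /char_poly /determinant coef_sum.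
rewrite -(pair_big_dep (fun S : {set 'I_n} => #|S| == k)
  (fun S (s : {perm 'I_n}) => perm_on S s)
  (fun S (s : {perm 'I_n}) => (-1) ^+ s * \prod_(i in S) A i (s i))) /=.
rewrite (exchange_big_dep xpredT) //= mulr_sumr; apply: eq_bigr => s _.
have -> : \prod_i char_poly_mx A i (s i) =
   \prod_i ((- A i (s i))%:P + 'X *+ (i == s i)).
  by apply: eq_bigr => i _; rewrite !mxE addrC polyCN.
have -> : (-1) ^+ s = ((-1) ^+ s)%:P :> {poly R} by rewrite rmorphXn rmorphN1.
(* [J] is the set of indices at which the constant summand is chosen. *)
rewrite bigA_distr coefCM coef_sum !mulr_sumr [RHS]big_mkcond; apply: eq_bigr => J _.
have -> : \prod_i (if i \in J then (- A i (s i))%:P else 'X *+ (i == s i)) =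
    (\prod_(i in J) (- A i (s i)))%:P * \prod_(i in [predC J]) ('X *+ (i == s i)).
  rewrite (bigID (mem J)) rmorph_prod /=; congr (_ * _).
    by apply: eq_bigr => i ->.
  by apply: eq_bigr => i /negbTE->.
rewrite coefCM prodrN.
case: ifPn => [/andP[/eqP cJ onJ]|].
  rewrite (eq_bigr (fun=> 'X)) => [|i iJ]; last first.
    by rewrite (out_perm onJ iJ) eqxx.
  rewrite prodr_const coefXn.
  have -> : #|[predC J]| = (n - k)%N.
    by rewrite -cJ -[X in (X - _)%N](card_ord n) -(cardC (mem J)) addKn.
  by rewrite eqxx mulr1 cJ mulrCA.
rewrite negb_and; case: (boolP (perm_on J s)) => [onJ|noJ]; rewrite ?orbF => cJ.
  rewrite (eq_bigr (fun=> 'X)) => [|i iJ]; last first.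
    by rewrite (out_perm onJ iJ) eqxx.
  rewrite prodr_const coefXn.
  have -> : #|[predC J]| = (n - #|J|)%N.
    by rewrite -[X in (X - _)%N](card_ord n) -(cardC (mem J)) addKn.
  have leJ : (#|J| <= n)%N by rewrite -[leqRHS](card_ord n) max_card.
  (* Since [k] and [#|J|] are at most [n], truncated subtraction from [n] is injective on them:
     equal degrees force [#|J| = k]. *)
  case: eqP => [E|_]; last by rewrite !mulr0.
  by case/eqP: cJ; rewrite -(subKn leJ) -E subKn.
case/subsetPn: noJ => i; rewrite inE => si iJ.
by rewrite (bigD1 i iJ) /= eq_sym (negbTE si) mulr0n mul0r coef0 !mulr0.
Qed.

(** * Transport of permutations along a bijection *)

Section PermConj.
Variables (T U : finType) (h : T -> U) (g : U -> T).
Hypotheses (hK : cancel h g) (gK : cancel g h).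

Lemma conj_perm_inj (s : {perm T}) : injective (fun u => h (s (g u))).
Proof. by move=> u v /(can_inj hK)/perm_inj/(can_inj gK). Qed.

Definition conj_perm (s : {perm T}) : {perm U} := perm (@conj_perm_inj s).

Lemma conj_permE s x : conj_perm s (h x) = h (s x).
Proof. by rewrite permE hK. Qed.

Lemma porbit_conj_perm s x : porbit (conj_perm s) (h x) = h @: porbit s x.
Proof.
have conjX i : (conj_perm s ^+ i)%g (h x) = h ((s ^+ i)%g x).
  by elim: i => [|i IH]; rewrite ?expg0 ?perm1 // !expgSr !permM IH conj_permE.
apply/setP => y; apply/porbitP/imsetP => [[i ->]|[z /porbitP[i ->] ->]].
  by exists ((s ^+ i)%g x); rewrite ?mem_porbit.
by exists i; rewrite conjX.
Qed.

(** Parity is read off from the number of points and the number of orbits, and a bijection preserves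
    both. *)
Lemma odd_conj_perm s : conj_perm s = s :> bool.
Proof.
rewrite /odd_perm; congr (odd _ (+) odd _).
  by rewrite -(card_codom (can_inj hK)); apply: eq_card => y;
    rewrite inE; symmetry; apply/codomP; exists (g y); rewrite gK.
have -> : porbits (conj_perm s) = imset (fun A : {set T} => h @: A) (mem (porbits s)).
  rewrite /porbits -imset_comp; apply/setP => C; apply/imsetP/imsetP.
    by case=> u _ ->; exists (g u); rewrite //= -porbit_conj_perm gK.
  by case=> x _ ->; exists (h x); rewrite //= porbit_conj_perm.
by rewrite card_imset //; apply/imset_inj/(can_inj hK).
Qed.

Lemma perm_on_conj (S : {set T}) s : perm_on (h @: S) (conj_perm s) = perm_on S s.
Proof.
apply/subsetP/subsetP => onS x; rewrite inE => sx.
  have := onS (h x); rewrite inE conj_permE (can_eq hK) => /(_ sx).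
  by rewrite mem_imset //; apply: can_inj hK.
move: sx; rewrite -(gK x) conj_permE (can_eq hK) => sx.
by apply: imset_f; apply: onS; rewrite inE.
Qed.

End PermConj.

Lemma conj_permK (T U : finType) (h : T -> U) (g : U -> T)
    (hK : cancel h g) (gK : cancel g h) :
  cancel (conj_perm hK gK) (conj_perm gK hK).
Proof. by move=> s; apply/permP => x; rewrite !permE !hK. Qed.

(** Passes from the ordinals indexing the matrix to the edges of the graph, which are the vertices
    of the signed graph. *)
Lemma sum_principal_minors_reindex (R : comNzRingType) (T U : finType)
    (h : T -> U) (g : U -> T) (hK : cancel h g) (gK : cancel g h) (k : nat)
    (A : U -> U -> R) :
  \sum_(p : {set U} * {perm U} | (#|p.1| == k) && perm_on p.1 p.2)
     (-1) ^+ p.2 * \prod_(i in p.1) A i (p.2 i) =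
  \sum_(p : {set T} * {perm T} | (#|p.1| == k) && perm_on p.1 p.2)
     (-1) ^+ p.2 * \prod_(i in p.1) A (h i) (h (p.2 i)).
Proof.
pose F (p : {set T} * {perm T}) := (h @: p.1, conj_perm hK gK p.2).
pose F' (p : {set U} * {perm U}) := (g @: p.1, conj_perm gK hK p.2).
rewrite (reindex F) /=; last first.
  apply: onW_bij; exists F' => -[S s]; rewrite /F /F' /= conj_permK -imset_comp.
    by rewrite (eq_imset (g := id)) ?imset_id // => x /=; rewrite hK.
  by rewrite (eq_imset (g := id)) ?imset_id // => x /=; rewrite gK.
apply: eq_big => [[S s]|[S s] _] /=.
  by rewrite perm_on_conj card_imset //; apply: can_inj hK.
rewrite odd_conj_perm big_imset /= => [|x y _ _ /(can_inj hK)//].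
by congr (_ * _); apply: eq_bigr => i _; rewrite conj_permE.
Qed.

(** * Entries of the Hodge Laplacian *)

Lemma set2_eq (T : finType) (a b c d : T) :
  [set a; b] = [set c; d] -> (a = c /\ b = d) \/ (a = d /\ b = c).
Proof.
move=> E; have /set2P a_cd : a \in [set c; d] by rewrite -E set21.
have /set2P b_cd : b \in [set c; d] by rewrite -E set22.
have /set2P c_ab : c \in [set a; b] by rewrite E set21.
have /set2P d_ab : d \in [set a; b] by rewrite E set22.
by case: a_cd => ?; case: b_cd => ?; case: c_ab => ?; case: d_ab => ?; subst; auto.
Qed.

Lemma mem_unordered_pairs (T : finType) (P : rel T) : symmetric P ->
  forall x y, ([set x; y] \in [set [set p.1; p.2] | p : T * T & P p.1 p.2]) = P x y.
Proof.
move=> symP x y; apply/imsetP/idP => [[[a b]]|Pxy]; last by exists (x, y); rewrite ?inE.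
by rewrite inE /= => Pab /set2_eq[] [-> ->]; rewrite // symP.
Qed.

(** The signed adjacency matrix of [L], with the loops counted on the diagonal. *)
Definition ws_entry (L : wsgraph) (x y : L) : int :=
  if x == y then (weight x)%:Z else
  if [set x; y] \in pos_edges L :|: neg_edges L then sgn_edge [set x; y] else 0.

Section HodgeEntries.
Local Notation head := Defs.head.
Variables (G : sgraph) (o : edge_orientation G) (r : triangle_orientation G).
Implicit Types (e f : edge G) (t : triangle G).

Lemma line_pos_sym : symmetric (line_pos o).
Proof.
move=> e f; rewrite /line_pos eq_sym /co_oriented [head o e == _]eq_sym [tail o e == _]eq_sym.
by congr [&& _, _ & ~~ _]; apply: eq_existsb => t; rewrite andbC.
Qed.

Lemma line_neg_sym : symmetric (line_neg o).
Proof.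
move=> e f; rewrite /line_neg eq_sym /consecutive orbC.
by congr [&& _, _ & ~~ _]; apply: eq_existsb => t; rewrite andbC.
Qed.

Lemma edge_eq e f : (tail o e = tail o f /\ head o e = head o f) \/
  (tail o e = head o f /\ head o e = tail o f) -> e = f.
Proof.
move=> ef; apply: val_inj; rewrite !(tail_headE o).
by case: ef => -[-> ->]; rewrite // setUC.
Qed.

(* The entry of [incidence *m incidence^T] at distinct edges, cancelled by the
   [triangle_edge] part as soon as the edges lie in a common triangle. *)
Definition bsign e f : int := (co_oriented o e f)%:Z - (consecutive o e f)%:Z.

Lemma incidence_gram e f :
  (incidence o *m (incidence o)^T) (enum_rank e) (enum_rank f) =
  if e == f then 2 else bsign e f.
Proof.
rewrite mxE (reindex enum_rank) /=; last exact/onW_bij/enum_rank_bij.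
under eq_bigr => v _ do rewrite !mxE !enum_rankK /=.
(* Written as a difference of indicators, the entries multiply out to four Kronecker deltas. *)
have E g v : (if v == tail o g then -1 else if v == head o g then 1 else 0) =
    (v == head o g)%:Z - (v == tail o g)%:Z.
  have := tail_neq_head o g.
  case: (v =P tail o g) => [->|_]; last by move=> _; rewrite subr0; case: eqP.
  by move=> /negbTE->; rewrite sub0r.
under eq_bigr => v _ do rewrite !E mulrBr !mulrBl opprB.
have D (x y : G) : \sum_(v : G) (v == x)%:Z * (v == y)%:Z = (x == y)%:Z.
  rewrite (bigD1 x) //= eqxx mul1r big1 ?addr0 // => v /negbTE->.
  by rewrite mul0r.
rewrite big_split /= !sumrB !D /bsign /co_oriented /consecutive.
have := tail_neq_head o e; have := tail_neq_head o f.
case: (e =P f) => [<-|nef].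
  by rewrite [head o e == tail o e]eq_sym !eqxx => /negbTE->.
(* Distinct edges of a simple graph share at most one end, so the sums of deltas reduce to the
   disjunctions in [bsign]. *)
have: ~~ ((tail o e == tail o f) && (head o e == head o f)).
  by apply/andP => -[/eqP tt /eqP hh]; apply: nef; apply: edge_eq; left.
have: ~~ ((tail o e == head o f) && (head o e == tail o f)).
  by apply/andP => -[/eqP tt /eqP hh]; apply: nef; apply: edge_eq; right.
rewrite [head o f == _]eq_sym.
have [-> | _] := eqVneq (head o e) (head o f).
  rewrite andbT => _ /negbTE-> tf /negbTE->.
  by rewrite [head o f == _]eq_sym (negbTE tf).
have [-> | _] := eqVneq (head o e) (tail o f).
  by rewrite andbT => /negbTE-> _ _ /negbTE->.
have [-> | _] := eqVneq (tail o e) (tail o f); last by case: (_ == _).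
by move=> _ _ /negbTE->.
Qed.

Lemma incident_triangle e t :
  edge_in_triangle e t = (tail o e \in val t) && (head o e \in val t).
Proof. by rewrite /edge_in_triangle (tail_headE o) subUset !sub1set. Qed.

Lemma tour_uniq t : uniq (tour r t).
Proof.
apply/card_uniqP; rewrite size_tuple; have := valP t; rewrite inE => /andP[/eqP card_t _].
by rewrite -[RHS]card_t (tourE r) cardsE.
Qed.

Definition agreement e t : int := if agrees o r e t then 1 else -1.

Lemma agreement_sqr e t : agreement e t * agreement e t = 1.
Proof. by rewrite /agreement; case: ifP. Qed.

(** Two edges of a triangle meet in one vertex. If one enters it and the other leaves it, both agree
    or both disagree with the cyclic orientation; otherwise exactly one agrees. *)
Lemma agreementM e f t : edge_in_triangle e t -> edge_in_triangle f t ->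
  e != f -> agreement e t * agreement f t = - bsign e f.
Proof.
rewrite /agreement /agrees /bsign /co_oriented /consecutive !incident_triangle.
have mem_t x : (x \in val t) = (x \in tval (tour r t)) by rewrite (tourE r) inE.
have := size_tuple (tour r t); have := tour_uniq t; rewrite !mem_t {mem_t}.
case: (tval (tour r t)) => [|a[|b[|c[]]]] //= + _.
rewrite !inE !negb_or andbT => /andP[/andP[nab nac] nbc].
have := tail_neq_head o e; have := tail_neq_head o f; have := @edge_eq e f.
move: (tail o e) (head o e) (tail o f) (head o f) => te he tf hf K.
have {}K : e != f -> ~~ (((te == tf) && (he == hf)) || ((te == hf) && (he == tf))).
  by apply: contra => /orP[] /andP[/eqP ? /eqP ?]; apply/eqP/K; auto.
move=> nf ne /andP[/or3P te3 /or3P he3] /andP[/or3P tf3 /or3P hf3] /K.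
have [nba nca ncb] : [/\ b != a, c != a & c != b].
  by rewrite ![_ == a]eq_sym [c == b]eq_sym.
move: nf ne {K}; move: nab nac nbc nba nca ncb.
move=> /negbTE E1 /negbTE E2 /negbTE E3 /negbTE E4 /negbTE E5 /negbTE E6.
(* Finite check: each of the four ends is one of the three tour vertices. *)
by case: te3 => /eqP->; case: he3 => /eqP->; case: tf3 => /eqP->; case: hf3 => /eqP->;
  rewrite ?eqxx // ?(E1, E2, E3, E4, E5, E6, eqxx).
Qed.

Lemma triangle_gram e f :
  ((triangle_edge o r)^T *m triangle_edge o r) (enum_rank e) (enum_rank f) =
  \sum_(t | edge_in_triangle e t && edge_in_triangle f t)
    agreement e t * agreement f t.
Proof.
rewrite mxE (reindex enum_rank) /=; last exact/onW_bij/enum_rank_bij.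
rewrite [RHS]big_mkcond; apply: eq_bigr => t _; rewrite !mxE !enum_rankK /=.
by rewrite /agreement; do 2! case: edge_in_triangle; rewrite ?mul0r ?mulr0.
Qed.

(** Two distinct edges cover at least three vertices, hence all of any triangle containing both. *)
Lemma triangle_unique e f t t' : e != f ->
  edge_in_triangle e t && edge_in_triangle f t ->
  edge_in_triangle e t' && edge_in_triangle f t' -> t = t'.
Proof.
move=> nef et et'.
have card3 (s : triangle G) : #|val s| = 3%N.
  by have := valP s; rewrite inE => /andP[/eqP].
have card2 (g : edge G) : #|val g| = 2%N.
  by rewrite (tail_headE o) cards2 (tail_neq_head o).
have union (s : triangle G) :
      edge_in_triangle e s && edge_in_triangle f s -> val e :|: val f = val s.
  rewrite -subUset => ef_s; apply/eqP; rewrite eqEcard ef_s card3 ltnNge.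
  apply: contra nef => le2; rewrite -(inj_eq val_inj).
  have /eqP Ee : val e == val e :|: val f by rewrite eqEcard subsetUl card2.
  have /eqP Ef : val f == val e :|: val f by rewrite eqEcard subsetUr card2.
  by rewrite {1}Ee -Ef.
by apply: val_inj; rewrite -(union t) // -(union t').
Qed.

Lemma hodge_entry e f :
  hodge o r (enum_rank e) (enum_rank f) = @ws_entry (Lambda o) e f.
Proof.
rewrite /hodge mxE incidence_gram triangle_gram /ws_entry /=.
case: eqP => [<-|/eqP nef].
  rewrite (eq_bigl (mem [set t | edge_in_triangle e t])) => [|t]; last by rewrite /= inE andbb.
  under eq_bigr => t _ do rewrite agreement_sqr.
  by rewrite sumr_const PoszD [RHS]addrC; congr (_ + _); apply: natz.
rewrite /sgn_edge inE !mem_unordered_pairs; try exact: line_pos_sym; try exact: line_neg_sym.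
rewrite /line_pos /line_neg nef /=.
case: (boolP (share_triangle e f)) => [/existsP[t et]|/existsPn no_t] /=.
  (* The common triangle is unique, so its single contribution [- bsign e f] cancels the incidence
     part. *)
  rewrite !andbF (bigD1 t) //= big1 => [|t' /andP[et']]; last first.
    by rewrite (triangle_unique nef et' et) eqxx.
  by case/andP: et => et ft; rewrite addr0 agreementM // subrr.
rewrite big1 => [|t et]; last by case/negP: (no_t t).
rewrite addr0 !andbT /bsign; have := @co_oriented_consecutive G o e f nef.
by case: (co_oriented o e f) => [/(_ isT)/negbTE->|_]; case: (consecutive o e f).
Qed.

End HodgeEntries.

(** * Permutations and basic subgraphs *)

Section PermOrbits.
Variables (T : finType) (s : {perm T}).

Lemma porbit_fixed x : s x = x -> porbit s x = [set x].
Proof.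
move=> sx; apply/setP => y; rewrite inE; apply/porbitP/eqP => [[i ->]|->].
  by elim: i => [|i IH]; rewrite ?expg0 ?perm1 // expgSr permM IH.
by exists 0%N; rewrite expg0 perm1.
Qed.

Lemma perm_mem_porbit x y : (s y \in porbit s x) = (y \in porbit s x).
Proof. by rewrite -!eq_porbit_mem -[in LHS](expg1 s) porbit_perm. Qed.

Lemma card_porbit_gt1 x : (1 < #|porbit s x|)%N = (s x != x).
Proof.
apply/idP/idP => [|sx]; last first.
  apply/card_gt1P; exists x, (s x); rewrite perm_mem_porbit porbit_id.
  by rewrite eq_sym sx.
by apply: contraTneq => /porbit_fixed->; rewrite cards1.
Qed.

Lemma card_porbit_gt2 x : (2 < #|porbit s x|)%N -> s (s x) != x.
Proof.
have := uniq_traject_porbit s x; case: #|_| => [|[|[|n]]] //=.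
by rewrite !inE !negb_or => /and3P[/and3P[_ + _] _ _] _; rewrite eq_sym.
Qed.

Lemma porbit2E x : #|porbit s x| = 2%N -> porbit s x = [set x; s x].
Proof. by move=> c2; apply/setP => y; rewrite porbit_traject c2 !inE. Qed.

Lemma porbit_eq x y : y \in porbit s x -> porbit s y = porbit s x.
Proof. by rewrite -eq_porbit_mem => /eqP. Qed.

Lemma next_traject_porbit x y : y \in porbit s x ->
  next (traject s x #|porbit s x|) y = s y.
Proof.
rewrite porbit_traject => xy; apply/esym/eqP.
suff cyc : fcycle s (traject s x #|porbit s x|) by apply: next_cycle cyc xy.
have /= := iter_porbit s x; case: #|_| => [//|n] it.
by rewrite /= -[X in rcons _ X]it iterSr -trajectSr fpath_traject.
Qed.

End PermOrbits.

(** Fixed points are left out: they would give singletons, and are to become isolated vertices. *)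
Definition perm_edges (T : finType) (S : {set T}) (s : {perm T}) : {set {set T}} :=
  [set [set x; s x] | x in S & s x != x].

Lemma perm_edgesP (T : finType) (S : {set T}) (s : {perm T}) (f : {set T}) :
  reflect (exists x, [/\ x \in S, s x != x & f = [set x; s x]])
          (f \in perm_edges S s).
Proof.
apply: (iffP imsetP) => [[x]|[x [xS sx ->]]].
  by rewrite inE => /andP[xS sx] ->; exists x.
by exists x; rewrite ?inE ?xS.
Qed.

Lemma sub_adj_sym (L : wsgraph) (B : {set L} * {set {set L}}) : symmetric (sub_adj B).
Proof. by move=> x y; rewrite /sub_adj /= setUC. Qed.

Lemma connect_sub_adj_equivalence (L : wsgraph) (B : {set L} * {set {set L}}) :
  {in B.1 & &, equivalence_rel (connect (sub_adj B))}.
Proof.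
move=> x y z _ _ _; split=> // xy.
by apply: same_connect => //; apply/sym_connect_sym/sub_adj_sym.
Qed.

Lemma components_partition (L : wsgraph) (B : {set L} * {set {set L}}) :
  partition (components B) B.1.
Proof. exact/equivalence_partitionP/connect_sub_adj_equivalence. Qed.

(** * The subgraph of a permutation and its term *)

Section PermSubgraph.
Variables (L : wsgraph) (S : {set L}) (s : {perm L}).
Hypothesis onS : perm_on S s.
Local Notation B := ((S, perm_edges S s) : {set L} * {set {set L}}).

Lemma porbit_sub x : x \in S -> porbit s x \subset S.
Proof.
move=> xS; apply/subsetP => y /porbitP[i ->].
by elim: i => [|i IH]; rewrite ?expg0 ?perm1 // expgSr permM perm_closed.
Qed.

Lemma sub_adj_perm x y :
  sub_adj B x y = [&& x \in S, x != y & (y == s x) || (x == s y)].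
Proof.
apply/perm_edgesP/idP => [[z [zS sz /set2_eq[] [-> ->]]]|].
- by rewrite zS eq_sym sz eqxx.
- by rewrite perm_closed // zS sz eqxx orbT.
case/and3P=> xS nxy /orP[/eqP E|/eqP E].
  by exists x; rewrite xS -E eq_sym.
by exists y; rewrite -(perm_closed y onS) -E nxy setUC.
Qed.

(** Each step along an edge applies [s] or its inverse, so a path never leaves the orbit. *)
Lemma connect_porbit x y : x \in S -> connect (sub_adj B) x y = (y \in porbit s x).
Proof.
move=> xS; apply/idP/idP.
  case/connectP=> p; elim: p x {xS} => [|z p IH] x /=; first by move=> _ ->; rewrite porbit_id.
  rewrite sub_adj_perm => /andP[/and3P[_ _ adj] zp] /(IH _ zp).
  suff /porbit_eq-> : z \in porbit s x by [].
  by case/orP: adj => /eqP->; last rewrite porbit_sym; rewrite perm_mem_porbit porbit_id.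
case/porbitP=> i ->; elim: i => [|i IH]; first by rewrite expg0 perm1 connect0.
rewrite expgSr permM; apply: connect_trans IH _; set z := (s ^+ i)%g x.
have [sz|sz] := eqVneq (s z) z; first by rewrite sz connect0.
apply: connect1; rewrite sub_adj_perm eq_sym sz eqxx andbT.
by apply: (subsetP (porbit_sub xS)); rewrite mem_porbit.
Qed.

Lemma components_perm : components B = porbit s @: S.
Proof.
apply: eq_in_imset => x xS; apply/setP => y; rewrite inE connect_porbit //.
by apply: andb_idl; apply: subsetP (porbit_sub xS) y.
Qed.

Lemma comp_edges_perm x : x \in S ->
  comp_edges B (porbit s x) = perm_edges (porbit s x) s.
Proof.
move=> xS; apply/setP => f; rewrite inE; apply/andP/perm_edgesP => /=.
  case=> /perm_edgesP[z [zS sz ->]]; rewrite subUset !sub1set => /andP[zx _].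
  by exists z.
case=> z [zx sz ->]; split; last by rewrite subUset !sub1set perm_mem_porbit zx.
by apply/perm_edgesP; exists z; split=> //; apply: subsetP zx; apply: porbit_sub.
Qed.

Lemma is_isolated_perm x : x \in S -> is_isolated B (porbit s x) = (#|porbit s x| == 1%N).
Proof.
move=> xS; apply: andb_idr => /eqP c1; rewrite comp_edges_perm //.
apply/eqP/setP => f; rewrite inE; apply/perm_edgesP => -[z [zx sz _]].
by move: sz; rewrite -card_porbit_gt1 (porbit_eq zx) c1.
Qed.

Lemma is_single_edge_perm x : x \in S -> is_single_edge B (porbit s x) = (#|porbit s x| == 2%N).
Proof.
move=> xS; apply: andb_idr => /eqP c2; rewrite comp_edges_perm //.
apply/eqP/setP => f; rewrite inE; apply/perm_edgesP/eqP => [[z [zx sz ->]]|->].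
  by rewrite -(porbit_eq zx) porbit2E // (porbit_eq zx).
by exists x; rewrite porbit_id -card_porbit_gt1 c2 porbit2E.
Qed.

Lemma perm_edges_porbit x : (1 < #|porbit s x|)%N ->
  perm_edges (porbit s x) s = [set [set z; s z] | z in porbit s x].
Proof.
move=> c1; apply/setP => f; apply/perm_edgesP/imsetP => [[z [zx _ ->]]|[z zx ->]].
  by exists z.
by exists z; rewrite -card_porbit_gt1 (porbit_eq zx).
Qed.

Lemma is_cycle_perm x : x \in S -> is_cycle B (porbit s x) = (2 < #|porbit s x|)%N.
Proof.
move=> xS; apply: andb_idr => c3; apply/existsP.
exists (Tuple (introT eqP (size_traject s x #|porbit s x|))) => /=.
rewrite uniq_traject_porbit comp_edges_perm // perm_edges_porbit ?(ltnW c3) //.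
apply/and3P; split=> //; first by apply/eqP/setP => y; rewrite inE -porbit_traject.
by apply/eqP/eq_in_imset => y /next_traject_porbit <-.
Qed.

(** The components are orbits, and orbits of size one, two and at least three are isolated vertices,
    single edges and cycles. *)
Lemma is_basic_perm : is_basic B = is_subgraph B.
Proof.
apply: andb_idr => _; apply/forall_inP => C; rewrite components_perm => /imsetP[x xS ->].
rewrite is_isolated_perm // is_single_edge_perm // is_cycle_perm //.
by have := card_porbit_neq0 s x; case: #|_| => [|[|[|]]].
Qed.

(** Parity counts points plus orbits; each point outside [S] is an orbit of its own, so it is
    counted twice and cancels. *)
Lemma sign_perm_components : (-1) ^+ s = (-1) ^+ (#|S| + #|components B|) :> int.
Proof.
rewrite -[RHS]signr_odd oddD /odd_perm components_perm; congr (_ ^+ (nat_of_bool _)).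
have -> : porbits s = (porbit s @: S) :|: (porbit s @: ~: S).
  rewrite -imsetU setUCr; apply/setP => C.
  by apply/imsetP/imsetP => -[x _ ->]; exists x; rewrite ?inE.
rewrite cardsU disjoint_setI0 ?cards0 ?subn0; last first.
  rewrite -setI_eq0; apply/eqP/setP => C; rewrite !inE; apply/andP => -[/imsetP[x xS ->]].
  case/imsetP=> y; rewrite inE => /negP yS E; case: yS.
  by apply: (subsetP (porbit_sub xS)); rewrite E porbit_id.
rewrite (card_in_imset (D := ~: S)); last first.
  move=> x y; rewrite !inE => xS yS.
  by rewrite !porbit_fixed ?(out_perm onS) // => /set1_inj.
by rewrite -(cardsC S) !oddD; case: odd; case: odd; case: odd.
Qed.

Lemma is_subgraph_perm :
  is_subgraph B = (perm_edges S s \subset pos_edges L :|: neg_edges L).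
Proof.
apply: andb_idr => _; apply/bigcupsP => f /perm_edgesP[x [xS _ ->]].
by rewrite subUset !sub1set perm_closed ?xS.
Qed.

Lemma prod_ws_entry_eq0 : ~~ is_subgraph B -> \prod_(x in S) ws_entry x (s x) = 0.
Proof.
rewrite is_subgraph_perm => /subsetPn[f /perm_edgesP[x [xS sx ->]] nf].
by rewrite (bigD1 x) //= /ws_entry eq_sym (negbTE sx) (negbTE nf) mul0r.
Qed.

Lemma sgn_edgeP (f : {set L}) : sgn_edge f = 1 \/ sgn_edge f = -1.
Proof. by rewrite /sgn_edge; case: ifP; auto. Qed.

Lemma cycle_sgnP (C : {set L}) : cycle_sgn B C = 1 \/ cycle_sgn B C = -1.
Proof.
rewrite /cycle_sgn; apply: (big_ind (fun z : int => z = 1 \/ z = -1)); first by left.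
  by move=> y z [] -> [] ->; rewrite ?mulrNN ?mul1r ?mulr1; auto.
by move=> f _; apply: sgn_edgeP.
Qed.

(** On an orbit of size at least three distinct points yield distinct edges; on an orbit of size two
    the edge would occur twice. *)
Lemma cycle_sgn_perm x : x \in S -> (2 < #|porbit s x|)%N ->
  cycle_sgn B (porbit s x) = \prod_(y in porbit s x) sgn_edge [set y; s y].
Proof.
move=> xS c3; rewrite /cycle_sgn comp_edges_perm // perm_edges_porbit ?(ltnW c3) //.
rewrite big_imset //= => y z yx zx /set2_eq[[]//|[E1 E2]].
have := @card_porbit_gt2 _ s z; rewrite (porbit_eq zx) => /(_ c3).
by rewrite -E1 E2 eqxx.
Qed.

(** A fixed point contributes its weight. A transposition contributes the square of an edge sign
    times [(-1) ^+ 3], that is [-1]. A longer orbit contributes its cycle sign, negated for even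
    length, which is [-1] exactly for negative odd and positive even cycles. *)
Lemma term_component x : x \in S -> is_subgraph B ->
  let C := porbit s x in
  (-1) ^+ #|C|.+1 * \prod_(y in C) ws_entry y (s y) =
  (if is_single_edge B C then -1 else 1) *
  (if [&& is_cycle B C, odd #|C| & cycle_sgn B C == -1] then -1 else 1) *
  (if [&& is_cycle B C, ~~ odd #|C| & cycle_sgn B C == 1] then -1 else 1) *
  \prod_(y in C) (if s y == y then (weight y)%:Z else 1).
Proof.
move=> xS; rewrite is_subgraph_perm => /subsetP subB C.
have entryE y : y \in C -> s y != y -> ws_entry y (s y) = sgn_edge [set y; s y].
  move=> yC sy; rewrite /ws_entry eq_sym (negbTE sy) subB //.
  by apply/perm_edgesP; exists y; rewrite (subsetP (porbit_sub xS)).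
rewrite is_single_edge_perm // is_cycle_perm //.
have [c1|c1] := leqP #|C| 1.
  have cC : #|C| = 1%N by apply/eqP; rewrite eqn_leq c1 lt0n card_porbit_neq0.
  have sx : s x = x by apply/eqP; rewrite -[_ == _]negbK -card_porbit_gt1 -/C cC.
  by rewrite -/C cC /= !mul1r /C porbit_fixed // !big_set1 /ws_entry sx eqxx.
have moved y : y \in C -> s y != y.
  by move=> yC; rewrite -card_porbit_gt1 (porbit_eq yC).
have -> : \prod_(y in C) ws_entry y (s y) = \prod_(y in C) sgn_edge [set y; s y].
  by apply: eq_bigr => y yC; rewrite entryE ?moved.
rewrite [X in _ = _ * X]big1 ?mulr1 => [|y /moved/negbTE-> //].
move: c1; rewrite leq_eqVlt => /orP[/eqP/esym cC|c3].
  have sx := moved x (porbit_id s x).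
  rewrite -/C cC eqxx /= !mulr1 /C porbit2E // big_setU1 ?inE 1?eq_sym //= big_set1.
  have -> : s (s x) = x.
    have : s (s x) \in porbit s x by rewrite !perm_mem_porbit porbit_id.
    by rewrite porbit2E // !inE (inj_eq perm_inj) (negbTE sx) orbF => /eqP.
  rewrite [[set s x; x]]setUC; case: (sgn_edgeP [set x; s x]) => ->;
    by rewrite ?mulrNN ?mulr1 -signr_odd.
rewrite -/C c3 gtn_eqF //= mul1r -cycle_sgn_perm // -/C -signr_odd /=.
by case: (cycle_sgnP C) => ->; case: (odd #|C|).
Qed.

Lemma big_components (R : Type) (idx : R) (op : Monoid.com_law idx) (F : L -> R) :
  \big[op/idx]_(x in S) F x =
  \big[op/idx]_(C in components B) \big[op/idx]_(x in C) F x.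
Proof. exact/set_partition_big/(components_partition B). Qed.

Lemma isolated_weight_perm :
  (isolated_weight B)%:Z = \prod_(x in S) (if s x == x then (weight x)%:Z else 1).
Proof.
rewrite /isolated_weight (big_morph Posz PoszM (erefl _)) -big_mkcondr.
apply: eq_bigl => x; apply/andP/andP => [[]|[xS /eqP sx]].
  rewrite components_perm => /imsetP[y yS E] _.
  have xC : x \in porbit s y by rewrite -E set11.
  rewrite (subsetP (porbit_sub yS)) // -[_ == _]negbK -card_porbit_gt1.
  by rewrite (porbit_eq xC) -E cards1.
rewrite -(porbit_fixed sx) is_isolated_perm // components_perm imset_f //.
by rewrite porbit_fixed // cards1.
Qed.

Lemma sign_card_components (P : pred {set L}) :
  (-1) ^+ #|[set C in components B | P C]| =
  \prod_(C in components B) (if P C then -1 else 1) :> int.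
Proof.
rewrite -big_mkcondr -prodr_const; by apply: eq_bigl => C; rewrite inE.
Qed.

(** Every factor is a product over the components, so the identity is checked one component at a
    time. *)
Lemma term_perm : is_subgraph B ->
  (-1) ^+ s * \prod_(x in S) ws_entry x (s x) =
  (-1) ^+ (n_single_edges B + n_neg_odd_cycles B + n_pos_even_cycles B)
  * (isolated_weight B)%:Z.
Proof.
move=> subB; rewrite sign_perm_components isolated_weight_perm !exprD.
rewrite !sign_card_components -!prodr_const !big_components -!big_split /=.
apply: eq_bigr => C; rewrite components_perm => /imsetP[x xS ->].
by rewrite prodr_const -exprSr; apply: term_component.
Qed.

End PermSubgraph.

(** * Permutations with a given subgraph *)

Section Fibre.
Variables (L : wsgraph).
Implicit Types (B : {set L} * {set {set L}}) (s t : {perm L}) (F : {set {set L}}).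

Definition perm_fibre B : {set {perm L}} :=
  [set s | perm_on B.1 s & perm_edges B.1 s == B.2].

(** The edges at [x] determine its neighbours, and by [t] these are the image and the preimage of
    [x]. *)
Lemma perm_edges_neighbours (S : {set L}) s t : perm_on S s -> perm_on S t ->
  perm_edges S s = perm_edges S t -> forall x, s x = t x \/ s x = (t^-1)%g x.
Proof.
move=> onSs onSt E x; case: (boolP (x \in S)) => [xS|xS]; last first.
  by left; rewrite !(out_perm _ xS).
have [sx|sx] := eqVneq (s x) x.
  left; apply/eqP; rewrite sx; apply: contraT; rewrite eq_sym => tx.
  have /perm_edgesP[y [_ sy /set2_eq[] []]] : [set x; t x] \in perm_edges S s.
    by rewrite E; apply/perm_edgesP; exists x.
  - by move=> <-; rewrite sx => /eqP; rewrite (negbTE tx).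
  - by move=> xsy; case/eqP: sy; apply: (@perm_inj _ s); rewrite -xsy sx.
have /perm_edgesP[y [_ _ /set2_eq[] []]] : [set x; s x] \in perm_edges S t.
  by rewrite -E; apply/perm_edgesP; exists x.
- by move=> -> ->; left.
- by move=> -> ->; right; rewrite permK.
Qed.

(* Two permutations with the same edges that agree at [x] keep walking round
   the cycle in the same direction. *)
Lemma agree_on_porbit (S : {set L}) s t : perm_on S s -> perm_on S t ->
  perm_edges S s = perm_edges S t -> forall x, s x = t x ->
  {in porbit t x, s =1 t}.
Proof.
move=> onSs onSt E x sx y /porbitP[i ->]; elim: i => [|i IH]; first by rewrite expg0 perm1.
rewrite expgSr permM; set z := (t ^+ i)%g x in IH *.
have [//|Ey] := perm_edges_neighbours onSs onSt E (t z).
rewrite permK in Ey.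
have := perm_edges_neighbours onSt onSs (esym E) (t z).
by case=> [->//|tt]; rewrite Ey tt -IH permK.
Qed.

(* Reversing [s] on the orbits listed in [F] keeps its edge set; every
   permutation with this edge set arises so. *)
Section Flip.
Variables (s : {perm L}) (F : {set {set L}}).

Definition flip_fun x := if porbit s x \in F then (s^-1)%g x else s x.

Lemma porbit_flip_fun x : porbit s (flip_fun x) = porbit s x.
Proof.
rewrite /flip_fun; apply: porbit_eq; case: ifP => _; last by rewrite perm_mem_porbit porbit_id.
by rewrite -perm_mem_porbit permKV porbit_id.
Qed.

Lemma flip_fun_inj : injective flip_fun.
Proof.
move=> x y E; have := porbit_flip_fun y; rewrite -E porbit_flip_fun => Ep.
by move: E; rewrite /flip_fun Ep; case: ifP => _ /perm_inj.
Qed.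

Definition flip : {perm L} := perm flip_fun_inj.

Lemma flipE x : flip x = if porbit s x \in F then (s^-1)%g x else s x.
Proof. by rewrite permE. Qed.

Lemma flip_perm_on (S : {set L}) : perm_on S s -> perm_on S flip.
Proof.
move=> onS; apply/subsetP => x; rewrite inE flipE; apply: contraR => xS.
have sx := out_perm onS xS.
by case: ifP => _; apply/eqP; rewrite // -{1}sx permK.
Qed.

Lemma perm_edges_flip (S : {set L}) : perm_on S s -> perm_edges S flip = perm_edges S s.
Proof.
move=> onS; apply/setP => f; apply/perm_edgesP/perm_edgesP => -[x [xS sx ->]].
  move: sx; rewrite flipE; case: ifP => _ sx; last by exists x.
  (* The pair formed by [x] and its preimage is the edge that [s] produces at the preimage. *)
  exists ((s^-1)%g x); rewrite permKV -(perm_closed _ onS) permKV eq_sym sx.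
  by rewrite setUC.
case: (boolP (porbit s x \in F)) => xF; last first.
  by exists x; rewrite flipE (negbTE xF).
have xsF : porbit s (s x) \in F.
  by rewrite (@porbit_eq _ _ x) // perm_mem_porbit porbit_id.
by exists (s x); rewrite flipE xsF permK (perm_closed _ onS) eq_sym sx setUC.
Qed.

End Flip.

(** [flip s] maps the subsets of the set [Z] of cycle components bijectively onto the fibre. *)
Lemma card_perm_fibre B s : s \in perm_fibre B ->
  #|perm_fibre B| = (2 ^ n_cycles B)%N.
Proof.
case: B => S E; rewrite inE /= => /andP[onS /eqP <-{E}]; set B := (S, _).
rewrite /n_cycles -card_powerset; set Z := [set C in _ | _].
have memZ x : x \in S -> (porbit s x \in Z) = (2 < #|porbit s x|)%N.
  by move=> xS; rewrite inE is_cycle_perm // components_perm // imset_f.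
(* A cycle has a point where the two directions differ; this makes [flip s] injective on subsets of
   [Z]. *)
have repZ C : C \in Z -> exists x, [/\ x \in S, C = porbit s x & (s^-1)%g x != s x].
  move=> CZ; have := CZ; rewrite inE components_perm // => /andP[/imsetP[x xS EC] _].
  exists x; split=> //; move: CZ; rewrite EC memZ // => /card_porbit_gt2.
  by apply: contra => /eqP <-; rewrite permKV.
rewrite -(card_in_imset (f := flip s) (D := powerset Z)); last first.
  move=> F F'; rewrite !inE => /subsetP FZ /subsetP FZ' EF; apply/setP => C.
  have [CZ|CZ] := boolP (C \in Z); last first.
    by rewrite (contraNF (FZ C) CZ) (contraNF (FZ' C) CZ).
  have [x [xS -> nx]] := repZ C CZ.
  have := congr1 (fun u : {perm L} => u x) EF; rewrite !flipE.
  by case: (_ \in F); case: (_ \in F') => // E; rewrite E eqxx in nx.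
apply: eq_card => t; apply/idP/imsetP => [|[F _ ->]]; last first.
  by rewrite inE /= flip_perm_on // perm_edges_flip // eqxx.
rewrite inE /= => /andP[onSt /eqP Et].
(* The cycles to reverse are those that [t] traverses against [s]. *)
exists [set C in Z | [forall x in C, t x == (s^-1)%g x]].
  by rewrite inE; apply/subsetP => C; rewrite inE => /andP[].
apply/permP => x; rewrite flipE.
case: ifP => [|/negbT].
  by rewrite inE => /andP[_ /forall_inP/(_ x (porbit_id s x))/eqP].
have [xS|xS _] := boolP (x \in S); last by rewrite !(out_perm _ xS).
(* Either the orbit has at most two points, where [s] is its own inverse, or [t] follows [s] at some
   [y] and hence on the whole orbit. *)
rewrite inE negb_and => /orP[|/forall_inPn[y yx ty]].
  rewrite memZ // => nZ.
  have [//|->] := perm_edges_neighbours onSt onS Et x.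
  apply: (@perm_inj _ s); rewrite permKV; apply/esym/eqP.
  move: nZ; rewrite -leqNgt leq_eqVlt => /orP[/eqP c2|].
    have : s (s x) \in porbit s x by rewrite !perm_mem_porbit porbit_id.
    rewrite porbit2E // !inE => /orP[//|/eqP/perm_inj sx].
    by rewrite !sx.
  by rewrite ltnS leqNgt card_porbit_gt1 negbK => /eqP sx; rewrite !sx.
have [tsy|tsy] := perm_edges_neighbours onSt onS Et y; last by rewrite tsy eqxx in ty.
by apply: (agree_on_porbit onSt onS Et tsy); rewrite porbit_sym.
Qed.

(** Puts the three kinds of components in one form, a cyclic listing, from which a permutation can
    be defined by [next]. *)
Lemma component_tour B C : is_basic B -> C \in components B ->
  exists q : seq L, [/\ uniq q, C = [set x in q] &
    comp_edges B C = [set [set x; next q x] | x in C & next q x != x]].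
Proof.
case/andP=> _ /forall_inP bas CB; case/or3P: (bas C CB).
- case/andP=> /cards1P[x ->] /eqP->; exists [:: x]; split=> //.
    by apply/setP => y; rewrite !inE.
  apply/esym/setP => f; rewrite inE; apply/imsetP => -[y].
  by rewrite !inE /= => /andP[/eqP->]; rewrite !eqxx.
- case/andP=> /cards2P[x [y [nxy ->]]] /eqP->; exists [:: x; y].
  have nyx : y == x = false by rewrite eq_sym (negbTE nxy).
  split; first by rewrite /= inE nxy.
    by apply/setP => z; rewrite !inE.
  apply/setP => f; rewrite inE; apply/eqP/imsetP => [->|[z]].
    by exists x; rewrite ?inE /= !eqxx // nyx.
  by rewrite !inE /= => /andP[/orP[]/eqP-> _ ->]; rewrite ?eqxx ?nyx // setUC.
case/andP=> c3 /existsP[q /and3P[uq /eqP EC /eqP Ee]]; exists q; split=> //.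
rewrite Ee; apply/setP => f; apply/imsetP/imsetP => [[x xC ->]|[x]]; last first.
  by rewrite inE => /andP[xC _] ->; exists x.
exists x => //; rewrite inE xC /=.
have xq : x \in (q : seq L) by have /setP/(_ x) := EC; rewrite xC inE => <-.
have := size_tuple q; have := uq; move: c3.
(* Rotating the listing to start at [x] makes its successor the second entry, distinct from [x] by
   uniqueness. *)
case/rot_to: xq => i q' Eq; rewrite -(rot_uniq i) -(size_rot i) -(next_rot i) // Eq.
case: q' {Eq} => [|y q'] /= c3 uq' sz; first by rewrite -sz in c3.
by rewrite eqxx; move: uq'; rewrite inE negb_or eq_sym => /andP[/andP[]].
Qed.

Lemma perm_fibre_nonempty B : is_basic B -> exists s, s \in perm_fibre B.
Proof.
move=> basB; have /andP[/andP[/subsetP subE coverB] _] := basB.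
have [q Hq] : exists q : {set L} -> seq L, forall C, C \in components B ->
  [/\ uniq (q C), C = [set x in q C] &
    comp_edges B C = [set [set x; next (q C) x] | x in C & next (q C) x != x]].
  have [C|q Hq] := @fin_all_exists _ _ (fun C q => C \in components B -> [/\ uniq q,
     C = [set x in q] &
     comp_edges B C = [set [set x; next q x] | x in C & next q x != x]]).
    (* The empty listing is a default for sets that are not components. *)
    by have [/(component_tour basB)[q Hq]|_] := boolP (C \in components B);
      [exists q | exists [::]].
  by exists q.
have partB := components_partition B.
have [/eqP covB trivB _] := and3P partB.
pose comp x := pblock (components B) x.
have compP x : x \in B.1 -> comp x \in components B by rewrite -covB => /pblock_mem.
have mem_comp x : x \in B.1 -> x \in comp x by rewrite -covB mem_pblock.
(* The permutation walks along the chosen tour of each component and fixes all other points. *)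
pose g x := if x \in B.1 then next (q (comp x)) x else x.
have memq x y : x \in B.1 -> (y \in q (comp x)) = (y \in comp x).
  by move=> xB; have [_ E _] := Hq _ (compP x xB); rewrite [in RHS]E inE.
have g_comp x : x \in B.1 -> g x \in comp x.
  by move=> xB; rewrite /g xB -memq // mem_next memq // mem_comp.
have comp_sub x y : x \in B.1 -> y \in comp x -> y \in B.1.
  move=> xB yx; rewrite -covB; apply/bigcupP; exists (comp x) => //; exact: compP.
have compE x y : y \in comp x -> comp y = comp x by apply: same_pblock.
have gB x : (g x \in B.1) = (x \in B.1).
  have [xB|xB] := boolP (x \in B.1); first by rewrite (comp_sub x) ?g_comp.
  by rewrite /g (negbTE xB) (negbTE xB).
have g_inj : injective g.
  move=> x y E; have xyB : (x \in B.1) = (y \in B.1) by rewrite -gB E gB.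
  have [yB|yB] := boolP (y \in B.1); last first.
    by move: E; rewrite /g xyB (negbTE yB).
  have xB : x \in B.1 by rewrite xyB.
  have Ec : comp x = comp y.
    by rewrite -(compE x (g x)) ?g_comp // E (compE y) ?g_comp.
  move: E; rewrite /g xB yB Ec; have [uq _ _] := Hq _ (compP y yB).
  exact: (can_inj (prev_next uq)).
pose s := perm g_inj; have sE x : s x = g x by rewrite permE.
exists s; rewrite inE; apply/andP; split.
  by apply/subsetP => x; rewrite inE sE /g; case: ifP => //; rewrite eqxx.
apply/eqP/setP => f; apply/perm_edgesP/idP => [[x [xB]]|fB].
  rewrite sE /g xB => gx ->; have [_ _ Ee] := Hq _ (compP x xB).
  have : [set x; next (q (comp x)) x] \in comp_edges B (comp x).
    by rewrite Ee; apply/imsetP; exists x; rewrite // inE mem_comp.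
  by rewrite inE => /andP[].
have /eqP/cards2P[a [b [nab Ef]]] := ws_card2 (subE f fB).
have fsub : f \subset B.1 by apply: subset_trans coverB; apply: bigcup_sup.
have [aB bB] : a \in B.1 /\ b \in B.1.
  by move: fsub; rewrite Ef subUset !sub1set => /andP[].
(* The ends of an edge are connected, so every edge of [B] belongs to the tour of one component. *)
have bcomp : b \in comp a.
  have conn := @connect_sub_adj_equivalence _ B.
  by rewrite /comp pblock_equivalence_partition // connect1 // /sub_adj /= -Ef.
have : f \in comp_edges B (comp a).
  by rewrite inE fB Ef subUset !sub1set mem_comp.
have [_ _ ->] := Hq _ (compP a aB).
case/imsetP=> x; rewrite inE => /andP[xa gx] ->; exists x.
have xB := comp_sub a x aB xa.
by rewrite sE /g xB (compE a x xa).
Qed.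

End Fibre.

(** For fixed [S] the permutations are grouped by edge set. Terms of non-basic subgraphs vanish, and
    on each remaining fibre the term is constant, so the fibre size supplies the power of two. *)
Lemma sum_principal_minors_basic (L : wsgraph) (k : nat) :
  \sum_(p : {set L} * {perm L} | (#|p.1| == k) && perm_on p.1 p.2)
     (-1) ^+ p.2 * \prod_(x in p.1) ws_entry x (p.2 x) =
  \sum_(B : {set L} * {set {set L}} | is_basic B && (#|B.1| == k))
     (-1) ^+ (n_single_edges B + n_neg_odd_cycles B + n_pos_even_cycles B)
     * 2 ^+ n_cycles B * (isolated_weight B)%:Z.
Proof.
rewrite -(pair_big_dep (fun S : {set L} => #|S| == k)
  (fun S (s : {perm L}) => perm_on S s)
  (fun S (s : {perm L}) => (-1) ^+ s * \prod_(x in S) ws_entry x (s x))) /=.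
pose W (B : {set L} * {set {set L}}) : int :=
  (-1) ^+ (n_single_edges B + n_neg_odd_cycles B + n_pos_even_cycles B)
  * 2 ^+ n_cycles B * (isolated_weight B)%:Z.
transitivity (\sum_(B : {set L} * {set {set L}} | (#|B.1| == k) && is_basic (B.1, B.2))
    W (B.1, B.2)); last by apply: eq_big => -[S E] //=; rewrite andbC.
rewrite -(pair_big_dep (fun S : {set L} => #|S| == k)
  (fun S E => is_basic (S, E)) (fun S E => W (S, E))) /=.
apply: eq_bigr => S _.
rewrite (bigID (fun s => is_basic (S, perm_edges S s))) /= [X in _ + X]big1 ?addr0.
  rewrite (partition_big (perm_edges S) (fun E => is_basic (S, E))) => [|s /andP[]//].
  apply: eq_bigr => E basE.
  have [s sE] := perm_fibre_nonempty basE.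
  rewrite (eq_bigr (fun=> (-1) ^+ (n_single_edges (S, E) + n_neg_odd_cycles (S, E)
      + n_pos_even_cycles (S, E)) * (isolated_weight (S, E))%:Z)); last first.
    move=> t /andP[/andP[onS bas] /eqP Et]; rewrite -Et; apply: term_perm => //.
    by rewrite -is_basic_perm.
  rewrite (eq_bigl (mem (perm_fibre (S, E)))) => [|t]; last first.
    by rewrite /= !inE; case: (perm_on S t) => //=; case: eqP => [->|]; rewrite ?basE ?andbF.
  by rewrite sumr_const (card_perm_fibre sE) -mulr_natr natrX mulrAC.
move=> s /andP[onS nbas]; rewrite prod_ws_entry_eq0 ?mulr0 //.
by rewrite -is_basic_perm.
Qed.

Theorem theorem3p20 (G : sgraph) (o : edge_orientation G)
    (r : triangle_orientation G) (m : nat) (hm : m = #|{: edge G}|)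
    (m_gt0 : (1 <= m)%N) (k : nat) (hk : (1 <= k <= m)%N) :
  (char_poly (hodge o r))`_(m - k) =
  (-1) ^+ k *
  \sum_(B : {set Lambda o} * {set {set Lambda o}} | is_basic B && (#|B.1| == k))
     (-1) ^+ (n_single_edges B + n_neg_odd_cycles B + n_pos_even_cycles B)
     * 2 ^+ n_cycles B * (isolated_weight B)%:Z.
Proof.
rewrite {}hm in m_gt0 hk *; have /andP[_ le_km] := hk.
rewrite coef_char_poly_principal_minors //; congr (_ * _).
rewrite (sum_principal_minors_reindex (@enum_rankK _) (@enum_valK _)).
rewrite -(sum_principal_minors_basic (Lambda o)); apply: eq_bigr => -[S s] _ /=.
by congr (_ * _); apply: eq_bigr => e _; rewrite hodge_entry.
Qed.
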